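(* For every topological space $X$: (a) if Alice has a winning strategy in $\mathsf{G}_{\mathrm{bnd}}(\mathcal{O},\mathcal{O})$ over $X$, then Bob has a winning strategy in $\mathsf{G}(X)$; (b) if Alice has a winning strategy in $\mathsf{G}(X)$, then Bob has a winning strategy in $\mathsf{G}_{\mathrm{bnd}}(\mathcal{O},\mathcal{O})$ over $X$. Moreover, if $X$ is a regular space: (c) if Bob has a winning strategy in $\mathsf{G}_{\mathrm{bnd}}(\mathcal{O},\mathcal{O})$ over $X$, then Alice has a winning strategy in $\mathsf{G}(X)$; (d) if Bob has a winning strategy in $\mathsf{G}(X)$, then Alice has a winning strategy in $\mathsf{G}_{\mathrm{bnd}}(\mathcal{O},\mathcal{O})$ over $X$.
   Context: Here $\omega=\{0,1,2,\dots\}$ and $\mathcal{O}$ denotes the set of open covers of $X$. All games are played between Alice and Bob, with innings $n\in\omega$, Alice moving first in each inning and each player knowing all previous moves. In $\mathsf{G}_{\mathrm{bnd}}(\mathcal{O},\mathcal{O})$, in each inning $n$ Alice chooses $A_n\in\mathcal{O}$ and Bob responds with a finite $B_n\subset A_n$. Bob wins if $\bigcup_{n\in\omega}B_n\in\mathcal{O}$ and there is a $k\in\omega$ such that $|B_n|\le k$ for every $n\in\omega$; otherwise Alice wins. In $\mathsf{G}(X)$, in the first inning ($n=0$) Alice chooses a compact set $K_0\subset X$ and Bob responds with an open set $V_0\supset K_0$; then in each inning $n>0$ Alice chooses a point $x_n\in X$ and Bob responds with an open neighborhood $V_n$ of $x_n$. Alice wins if $\bigcup_{n\in\omega}V_n=X$,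 and Bob wins otherwise. *)

(* Defs.v *)
From mathcomp Require Import all_boot.
From mathcomp Require Import all_classical all_reals all_analysis.

Set Implicit Arguments.
Unset Strict Implicit.
Unset Printing Implicit Defensive.

Local Open Scope classical_set_scope.
Local Open Scope card_scope.

(* A two-player game of length omega: in inning n Alice moves first, choosing
   an a with [alegal n a], and Bob answers with a b such that [blegal n a b].
   [bob_wins a b] is the payoff of an infinite play; Alice wins otherwise. *)
Record game := Game {
  amove : Type;
  bmove : Type;
  alegal : nat -> amove -> Prop;
  blegal : nat -> amove -> bmove -> Prop;
  bob_wins : (nat -> amove) -> (nat -> bmove) -> Prop
}.

Definition history (G : game) (a : nat -> amove G) (b : nat -> bmove G)
    (n : nat) : seq (amove G * bmove G) :=
  mkseq (fun i => (a i, b i)) n.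

(* A strategy sees the whole history.  It is winning if its owner makes only
   legal moves as long as the opponent has done so, and wins every play in
   which the opponent always moves legally. *)
Definition alice_winning (G : game)
    (sigma : seq (amove G * bmove G) -> amove G) : Prop :=
  forall (a : nat -> amove G) (b : nat -> bmove G),
    (forall n, a n = sigma (history a b n)) ->
    (forall n, (forall m, (m < n)%N -> blegal m (a m) (b m)) ->
       alegal n (a n)) /\
    ((forall n, blegal n (a n) (b n)) -> ~ bob_wins a b).

Definition bob_winning (G : game)
    (tau : seq (amove G * bmove G) -> amove G -> bmove G) : Prop :=
  forall (a : nat -> amove G) (b : nat -> bmove G),
    (forall n, b n = tau (history a b n) (a n)) ->
    (forall n, (forall m, (m <= n)%N -> alegal m (a m)) ->
       blegal n (a n) (b n)) /\
    ((forall n, alegal n (a n)) -> bob_wins a b).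

Definition alice_has_winning_strategy (G : game) : Prop :=
  exists sigma : seq (amove G * bmove G) -> amove G, alice_winning sigma.

Definition bob_has_winning_strategy (G : game) : Prop :=
  exists tau : seq (amove G * bmove G) -> amove G -> bmove G, bob_winning tau.

Definition open_cover (X : topologicalType) (A : set (set X)) : Prop :=
  (forall U, A U -> open U) /\ \bigcup_(U in A) U = setT.

Definition Gbnd (X : topologicalType) : game := {|
  amove := set (set X);
  bmove := set (set X);
  alegal := fun _ A => open_cover A;
  blegal := fun _ A B => finite_set B /\ B `<=` A;
  bob_wins := fun _ B =>
    open_cover (\bigcup_n B n) /\ exists k : nat, forall n, B n #<= `I_k
|}.

(* [NoPoint] is legal only when X is empty, where Alice has no point to choose
   in the innings n > 0: the game then goes on with her passing. *)
Inductive GX_amove (X : Type) : Type :=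
  | CompactSet of set X
  | Point of X
  | NoPoint.
Arguments NoPoint {X}.

Definition GX_alegal (X : topologicalType) (n : nat) (a : GX_amove X) : Prop :=
  match a with
  | CompactSet K => n = 0%N /\ compact K
  | Point _ => (0 < n)%N
  | NoPoint => (0 < n)%N /\ (X -> False)
  end.

Definition GX_blegal (X : topologicalType) (a : GX_amove X) (V : set X) : Prop :=
  open V /\
  match a with
  | CompactSet K => K `<=` V
  | Point x => V x
  | NoPoint => True
  end.

Definition GX (X : topologicalType) : game := {|
  amove := GX_amove X;
  bmove := set X;
  alegal := @GX_alegal X;
  blegal := fun _ a V => GX_blegal a V;
  bob_wins := fun _ V => \bigcup_n V n <> setT
|}.

(* Main.v *)
Require Import Defs.
From mathcomp Require Import all_boot.
From mathcomp Require Import all_classical all_reals all_analysis.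

Set Implicit Arguments.
Unset Strict Implicit.
Unset Printing Implicit Defensive.

Local Open Scope classical_set_scope.
Local Open Scope card_scope.

(** For the first two implications, a move in one game is turned into a move in
    the other: the compact set of the first inning becomes a finite subcover of
    the current cover, a point becomes one member containing it, and the union
    of the chosen members is an open answer to the compact set or point.  The
    two plays then have the same union, and the selections are bounded because
    only the first one may have more than one member.

    Both converses measure subsets of X by a sigma-ideal P and look at its
    kernel K, the closed set of points all of whose open neighbourhoods are
    outside P.  If X is Lindelof, the complement of every open set containing K
    is in P (ideal_kernel_outside).  If X is regular and K is not compact,
    some open cover A0 has the property that finitely many sets from A0 always
    leave a set outside P uncovered (not_compact_ideal_kernel_cover), and Bob
    cannot afford bounded selections inside A0 for ever.

    Suppose that Bob wins the bounded covering game.  P consists of the sets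
    that Alice can cover by playing points.  In a position where all further
    answers of Bob to covers inside A0 have at most k members, the
    intersection over these covers A of the closures of the answers to A is,
    up to topological indistinguishability, a finite set.  Hence near each point
    x, once x has been played, whatever is still uncovered is off one of these
    closures.  By the Lindelof property countably many points x and successor
    positions are enough at each stage, and along infinitely many stages Bob's
    own strategy covers X, so Alice's points cover everything that Bob had not
    covered in the initial position (bounded_position_point_winning).  If K
    were not compact, then every position would have an extension in which Bob
    gives an answer larger than any prescribed number, so he would lose some
    play.  Hence K is compact; Alice plays K, then points covering the rest.

    Suppose that Bob wins the point game.  If X is not Lindelof, Alice repeats
    a cover without countable subcover.  Otherwise let P consist of the
    Rothberger subsets.  Were K compact, Bob would have an open answer V to it
    with a Rothberger complement, and the tree of his later answers, thinned
    to countable covers, would by a theorem of Pawlikowski (rothberger_branch)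
    have a branch covering that complement: a play that Bob loses.  So K is not
    compact, and whatever finite family Bob has picked from A0 leaves a
    non-Rothberger set.  Alice plays covers inside A0 that refine longer and
    longer stretches of the sequences of covers witnessing this; against
    selections of at most k sets, the stage where Bob's first k selections are
    removed defeats him (refining_cover_wins). *)

(** * Strategies as functions of the opponent's moves *)

(** The outputs produced, move after move, by a machine that sees its previous
    outputs and the current input. *)
Definition run (A B : Type) (f : seq B -> A -> B) (s : seq A) : seq B :=
  foldl (fun bs a => rcons bs (f bs a)) [::] s.

Lemma run_rcons (A B : Type) (f : seq B -> A -> B) s a :
  run f (rcons s a) = rcons (run f s) (f (run f s) a).
Proof. by rewrite /run foldl_rcons. Qed.

Lemma run_mkseq (A B : Type) (f : seq B -> A -> B) (a : nat -> A)
    (b : nat -> B) :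
    (forall n, b n = f (run f (mkseq a n)) (a n)) ->
  forall n, run f (mkseq a n) = mkseq b n.
Proof. by move=> bE; elim=> // n IH; rewrite !mkseqS run_rcons bE IH. Qed.

Lemma run_stream (A B : Type) (f : seq B -> A -> B) (a : nat -> A) :
  exists b : nat -> B, forall n,
    run f (mkseq a n) = mkseq b n /\ b n = f (mkseq b n) (a n).
Proof.
pose b n := f (run f (mkseq a n)) (a n).
have rb := @run_mkseq _ _ f a b (fun=> erefl).
by exists b => n; rewrite /b -rb.
Qed.

Lemma history_fst (G : game) (a : nat -> amove G) (b : nat -> bmove G) n :
  map fst (history a b n) = mkseq a n.
Proof. by rewrite /history /mkseq -map_comp. Qed.

Lemma history_snd (G : game) (a : nat -> amove G) (b : nat -> bmove G) n :
  map snd (history a b n) = mkseq b n.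
Proof. by rewrite /history /mkseq -map_comp. Qed.

(** Bob's own moves can be recomputed from Alice's, so a strategy may be given as
    a function of the opponent's moves alone.  Simulating one game inside
    another needs no bookkeeping in this form. *)
Definition bob_wins_by (G : game)
    (r : seq (amove G) -> amove G -> bmove G) : Prop :=
  forall a b, (forall n, b n = r (mkseq a n) (a n)) ->
    (forall n, (forall m, (m <= n)%N -> alegal m (a m)) ->
       blegal n (a n) (b n)) /\
    ((forall n, alegal n (a n)) -> bob_wins a b).

Definition alice_wins_by (G : game) (s : seq (bmove G) -> amove G) : Prop :=
  forall (a : nat -> amove G) (b : nat -> bmove G),
    (forall n, a n = s (mkseq b n)) ->
    (forall n, (forall m, (m < n)%N -> blegal m (a m) (b m)) ->
       alegal n (a n)) /\
    ((forall n, blegal n (a n) (b n)) -> ~ bob_wins a b).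

Lemma bob_wins_byP (G : game) :
  bob_has_winning_strategy G <-> exists r, @bob_wins_by G r.
Proof.
split=> [[tau tauW]|[r rW]]; last first.
  exists (fun h a => r (map fst h) a) => a b bE.
  by apply: rW => n; rewrite bE history_fst.
pose f h a := (a, tau h a).
exists (fun s a => tau (run f s) a) => a b bE; apply: tauW => n.
have <- // : run f (mkseq a n) = history a b n.
by apply: run_mkseq => m; rewrite /f bE.
Qed.

Lemma alice_wins_byP (G : game) :
  alice_has_winning_strategy G <-> exists s, @alice_wins_by G s.
Proof.
split=> [[sigma sigmaW]|[s sW]]; last first.
  exists (fun h => s (map snd h)) => a b aE.
  by apply: sW => n; rewrite aE history_snd.
pose f h (b : bmove G) := (sigma h, b).
exists (fun s => sigma (run f s)) => a b aE; apply: sigmaW => n.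
have <- // : run f (mkseq b n) = history a b n.
by apply: run_mkseq => m; rewrite /f aE.
Qed.

(** * Alice's strategies transfer to Bob *)

(** If there is no finite subcover, the sets obtained by removing finite
    subfamilies from K generate a proper filter without cluster point in K.
    X may be empty. *)
Lemma compact_finite_subcover (X : topologicalType) (K : set X)
    (A : set (set X)) :
    compact K -> (forall U, A U -> open U) -> K `<=` \bigcup_(U in A) U ->
  exists B, [/\ finite_set B, B `<=` A & K `<=` \bigcup_(U in B) U].
Proof.
move=> cK oA KA; apply: contrapT => noB.
pose F := [set S : set X | exists B : set (set X),
  [/\ finite_set B, B `<=` A & K `\` \bigcup_(U in B) U `<=` S]].
have F0 : ~ F set0.
  move=> [B [fB BA KB]]; apply: noB; exists B; split=> // x Kx.
  by apply: contrapT => nx; exact: (KB x).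
have FF : Filter F.
  apply: Build_Filter => [|P Q [B [fB BA BP]] [C [fC CA CQ]]|P Q PQ [B [? ? BP]]].
  - by exists set0; split.
  - exists (B `|` C); split; first by rewrite finite_setU.
      by move=> U [/BA|/CA].
    move=> x [Kx nx]; split; [apply: BP|apply: CQ]; split=> // -[U ? ?].
      by apply: nx; exists U => //; left.
    by apply: nx; exists U => //; right.
  - by exists B; split=> //; exact: subset_trans PQ.
have PF := Build_ProperFilter F0 FF.
have [x [Kx clx]] : K `&` cluster F !=set0.
  by apply: cK; exists set0; split=> // x [].
have [U AU Ux] := KA _ Kx.
have FU : F (K `\` U).
  exists [set U]; split; [exact: finite_set1|by move=> ? ->|].
  by move=> y [Ky ny]; split=> // Uy; apply: ny; exists U.
have nU : nbhs x U by apply: open_nbhs_nbhs; split=> //; exact: oA.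
by have [y [[_ nUy] Uy]] := clx _ _ FU nU.
Qed.

(** The set that an answer to a move of Alice has to contain. *)
Definition target (X : Type) (a : GX_amove X) : set X :=
  match a with
  | CompactSet K => K
  | Point x => [set x]
  | NoPoint => set0
  end.

Lemma exists_pick (X : topologicalType) (n : nat) (a : GX_amove X)
    (A : set (set X)) : GX_alegal n a -> open_cover A ->
  exists B, [/\ finite_set B, B `<=` A, target a `<=` \bigcup_(U in B) U &
    ~ (exists K, a = CompactSet K) -> B #<= `I_1].
Proof.
case: a => [K|x|] /= la [oA cA].
- case: la => n0 cK.
  have [|B [fB BA KB]] := compact_finite_subcover cK oA; first by rewrite cA.
  by exists B; split=> // -[]; exists K.
- have [U AU Ux] : (\bigcup_(U in A) U) x by rewrite cA.
  exists [set U]; split; [exact: finite_set1|by move=> ? ->| |].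
    by move=> ? ->; exists U.
  by move=> _; have := @card_set1 _ U; rewrite card_eq_le => /andP[].
- exists set0; split=> //.
Qed.

Lemma pick_function (X : topologicalType) :
  exists pick : GX_amove X -> set (set X) -> set (set X),
    forall n a A, GX_alegal n a -> open_cover A ->
      [/\ finite_set (pick a A), pick a A `<=` A,
          target a `<=` \bigcup_(U in pick a A) U &
          ~ (exists K, a = CompactSet K) -> pick a A #<= `I_1].
Proof.
suff /choice[pick pickP] : forall p : GX_amove X * set (set X),
    exists B, forall n, GX_alegal n p.1 -> open_cover p.2 ->
      [/\ finite_set B, B `<=` p.2, target p.1 `<=` \bigcup_(U in B) U &
          ~ (exists K, p.1 = CompactSet K) -> B #<= `I_1].
  exists (fun a A => pick (a, A)) => n a A.
  exact: (pickP (a, A) n).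
move=> [a A] /=.
have [[n [la cA]]|nl] := pselect (exists n, GX_alegal n a /\ open_cover A).
  by have [B BP] := exists_pick la cA; exists B.
by exists set0 => n la cA; exfalso; apply: nl; exists n.
Qed.

Lemma pick_blegal (X : topologicalType) (a : GX_amove X) (A B : set (set X)) :
    open_cover A -> B `<=` A -> target a `<=` \bigcup_(U in B) U ->
  GX_blegal a (\bigcup_(U in B) U).
Proof.
move=> [oA _] BA aB; split; first by apply: bigcup_open => U /BA /oA.
by case: a aB => //= x; apply.
Qed.

Lemma bounded_after_first (T : Type) (B : nat -> set T) :
    finite_set (B 0%N) -> (forall n, B n.+1 #<= `I_1) ->
  exists k, forall n, B n #<= `I_k.
Proof.
move=> /finite_set_leP[k Bk] B1; exists (maxn k 1) => -[|n].
  by apply: card_le_trans Bk _; rewrite card_le_II leq_maxl.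
by apply: card_le_trans (B1 n) _; rewrite card_le_II leq_maxr.
Qed.

Lemma alice_Gbnd_bob_GX (X : topologicalType) :
  alice_has_winning_strategy (Gbnd X) -> bob_has_winning_strategy (GX X).
Proof.
move=> /alice_wins_byP[s sW]; apply/bob_wins_byP.
have [pick pickP] := pick_function X.
pose f (Bs : seq (set (set X))) a := pick a (s Bs).
exists (fun xs (a : amove (GX X)) => \bigcup_(U in f (run f xs) a) U).
move=> a V VE; have [B BP] := run_stream f a.
have {}VE n : V n = \bigcup_(U in B n) U.
  by have [<- ->] := BP n; rewrite VE; have [-> _] := BP n.
have [covA WA] := sW (fun n => s (mkseq B n)) B (fun=> erefl).
have legalB n : (forall m, (m <= n)%N -> alegal (g := GX X) m (a m)) ->
    open_cover (s (mkseq B n)) /\ [/\ finite_set (B n), B n `<=` s (mkseq B n),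
      target (a n) `<=` \bigcup_(U in B n) U &
      ~ (exists K, a n = CompactSet K) -> B n #<= `I_1].
  elim/ltn_ind: n => n IH la.
  have cA : open_cover (s (mkseq B n)).
    apply: covA => m mn; have [|_ []//] := IH m mn.
    by move=> i im; apply: la; rewrite (leq_trans im)// ltnW.
  by split=> //; have [_ ->] := BP n; exact: (pickP n (a n) _ (la n (leqnn n)) cA).
split=> [n la|la].
  have [cA [_ BA aB _]] := legalB n la.
  by rewrite VE; apply: pick_blegal cA BA aB.
have {}legalB n := legalB n (fun m _ => la m).
have fB n : finite_set (B n) /\ B n `<=` s (mkseq B n).
  by have [_ []] := legalB n.
move=> VT; apply: (WA fB); split.
  split=> [U [n _ BU]|].
    by have [[oA _] [_ BA _ _]] := legalB n; apply: oA; exact: BA.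
  by rewrite bigcup_bigcup -VT; apply: eq_bigcupr => n _; rewrite VE.
apply: bounded_after_first => [|n]; first by have [] := fB 0%N.
have [_ [_ _ _ B1]] := legalB n.+1.
by apply: B1 => -[K aE]; have := la n.+1; rewrite /= aE => -[].
Qed.

Lemma alice_GX_bob_Gbnd (X : topologicalType) :
  alice_has_winning_strategy (GX X) -> bob_has_winning_strategy (Gbnd X).
Proof.
move=> /alice_wins_byP[s sW]; apply/bob_wins_byP.
have [pick pickP] := pick_function X.
pose f (Vs : seq (set X)) A := \bigcup_(U in pick (s Vs) A) U.
exists (fun As (A : amove (Gbnd X)) => pick (s (run f As)) A).
move=> A B BE; have [V VP] := run_stream f A.
have {}BE n : B n = pick (s (mkseq V n)) (A n).
  by have [<- _] := VP n; rewrite BE.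
have VE n : V n = \bigcup_(U in B n) U by rewrite BE; have [_ ->] := VP n.
have [legS WS] := sW (fun n => s (mkseq V n)) V (fun=> erefl).
have legalB n : (forall m, (m <= n)%N -> open_cover (A m)) ->
    GX_alegal n (s (mkseq V n)) /\ [/\ finite_set (B n), B n `<=` A n,
      target (s (mkseq V n)) `<=` \bigcup_(U in B n) U &
      ~ (exists K, s (mkseq V n) = CompactSet K) -> B n #<= `I_1].
  elim/ltn_ind: n => n IH la.
  have lS : GX_alegal n (s (mkseq V n)).
    apply: legS => m mn; rewrite /= VE.
    have lam i : (i <= m)%N -> open_cover (A i).
      by move=> im; apply: la; rewrite (leq_trans im)// ltnW.
    have [_ [_ BA aB _]] := IH m mn lam.
    exact: pick_blegal (lam _ (leqnn _)) BA aB.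
  by split=> //; rewrite BE; exact: (pickP n _ (A n) lS (la n (leqnn n))).
split=> [n la|la]; first by have [_ []] := legalB n la.
have {}legalB n := legalB n (fun m _ => la m).
have lV n : GX_blegal (s (mkseq V n)) (V n).
  by have [_ [_ BA aB _]] := legalB n; rewrite VE; apply: pick_blegal (la n) BA aB.
split.
  split=> [U [n _ BU]|].
    by have [oA _] := la n; have [_ [_ BA _ _]] := legalB n; apply: oA; exact: BA.
  apply: contrapT => nT; apply: (WS lV) => /= VT; apply: nT.
  by rewrite bigcup_bigcup -VT; apply: eq_bigcupr => n _; rewrite VE.
apply: bounded_after_first => [|n]; first by have [_ []] := legalB 0%N.
have [lS [_ _ _ B1]] := legalB n.+1.
by apply: B1 => -[K aE]; move: lS; rewrite aE => -[].
Qed.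

(** * Lindelof and regular spaces *)

Definition lindelof (X : topologicalType) : Prop :=
  forall A : set (set X), open_cover A ->
    exists C, [/\ countable C, C `<=` A & \bigcup_(U in C) U = setT].

(** Countable subcovers in the form of sequences of indices.  The index [i0] is
    only a default, for indices whose set has not been selected. *)
Lemma lindelof_sequence (X : topologicalType) (I : Type) (i0 : I)
    (O : I -> set X) (F : set X) :
    lindelof X -> closed F -> (forall i, open (O i)) ->
    F `<=` \bigcup_i O i ->
  exists g : nat -> I, F `<=` \bigcup_n O (g n).
Proof.
move=> lX cF oO FO.
have [|C [cC CA CT]] := lX [set U | U = ~` F \/ exists i, U = O i].
  split=> [U [->|[i ->]]|]; [exact: closed_openC|exact: oO|].
  rewrite -subTset => x _; have [Fx|nFx] := pselect (F x).
    by have [i _ Ox] := FO _ Fx; exists (O i) => //; right; exists i.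
  by exists (~` F) => //; left.
have /choice[idx idxP] : forall U, exists i, (exists j, U = O j) -> U = O i.
  by move=> U; have [[j ->]|nU] := pselect (exists j, U = O j);
    [exists j|exists i0].
have [C0|/unsquash u] := pfcard_geP cC.
  exists (fun=> i0) => x Fx; exfalso.
  by have [U] : (\bigcup_(U in C) U) x by [rewrite CT|]; rewrite C0.
exists (idx \o u) => x Fx.
have [U CU Ux] : (\bigcup_(U in C) U) x by rewrite CT.
have [n _ unU] : (u @` setT) U by apply: surj.
exists n => //=; rewrite unU; case: (CA _ CU) => [UF|UO].
  by move: Ux; rewrite UF.
by rewrite -idxP.
Qed.

(** Alice may repeat one cover for ever.  The finite selections then form a
    countable subfamily, so a winning Bob forces X to be Lindelof, and a cover
    without countable subcover wins for Alice. *)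
Lemma Gbnd_constant_play (X : topologicalType) (A : set (set X))
    (B : nat -> set (set X)) :
    (forall n, finite_set (B n) /\ B n `<=` A) ->
    open_cover (\bigcup_n B n) ->
  exists C, [/\ countable C, C `<=` A & \bigcup_(U in C) U = setT].
Proof.
move=> BA [_ cB]; exists (\bigcup_n B n); split=> //.
  by apply: bigcup_countable => // n _; apply: finite_set_countable; case: (BA n).
by move=> U [n _]; case: (BA n) => _; apply.
Qed.

Lemma regular_shrink (X : topologicalType) (x : X) (U : set X) :
    regular_space X -> open U -> U x ->
  exists W, [/\ open W, W x & closure W `<=` U].
Proof.
move=> rX oU Ux; have nU : nbhs x U by exact: open_nbhs_nbhs.
have [V nV VU] := rX x U nU.
move: nV; rewrite nbhsE => -[W [oW Wx] WV].
by exists W; split=> //; apply: subset_trans VU; exact: closure_subset.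
Qed.

Lemma closure_meets (X : topologicalType) (A U : set X) (x : X) :
  closure A x -> open U -> U x -> exists2 y, A y & U y.
Proof.
by move=> cAx oU Ux; have [y []] := cAx U (open_nbhs_nbhs (conj oU Ux)); exists y.
Qed.

Lemma closure_sub_closed (X : topologicalType) (A F : set X) :
  closed F -> A `<=` F -> closure A `<=` F.
Proof. by move=> cF AF x /(closure_subset AF); exact: cF. Qed.

Lemma closure_finite_bigcup (X : topologicalType) (B : set (set X)) :
  finite_set B -> closure (\bigcup_(U in B) U) `<=` \bigcup_(U in B) closure U.
Proof.
move=> fB; apply: closure_sub_closed.
  by apply: closed_bigcup => // U _; exact: closed_closure.
by move=> x [U BU Ux]; exists U => //; exact: subset_closure.
Qed.

(** In a regular space that need not be T0, points are separated only up to the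
    relation of having the same closure; this is its symmetry. *)
Lemma regular_closure1_sym (X : topologicalType) (x y : X) :
  regular_space X -> closure [set y] x -> closure [set x] y.
Proof.
move=> rX yx; apply: contrapT => nxy.
have oC : open (~` closure [set x]) by apply: closed_openC; exact: closed_closure.
have [W [oW Wy Wx]] := regular_shrink rX oC nxy.
apply: (Wx x); last exact: subset_closure.
by apply: (closure_subset _ yx) => ? ->.
Qed.

Lemma closure1_trans (X : topologicalType) (A : set X) (x y : X) :
  closure A y -> closure [set y] x -> closure A x.
Proof.
by move=> Ay; apply: closure_sub_closed; [exact: closed_closure|move=> ? ->].
Qed.

(** The points of [s] whose closure misses [z] form, with their closures, a
    finite union of closed sets missing [z]. *)
Lemma separate_points (X : topologicalType) (s : seq X) (z : X) :
    regular_space X ->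
  exists W, [/\ open W, W z &
    forall e, e \in s -> closure W e -> closure [set e] z].
Proof.
move=> rX.
pose D := [set e | e \in s /\ ~ closure [set e] z].
have fD : finite_set D.
  by apply: (sub_finite_set (B := [set` s])) => [e []//|]; exact: finite_seq.
have oO : open (~` \bigcup_(e in D) closure [set e]).
  apply: closed_openC; apply: closed_bigcup => // e _; exact: closed_closure.
have Oz : (~` \bigcup_(e in D) closure [set e]) z by move=> [e []].
have [W [oW Wz WO]] := regular_shrink rX oO Oz.
exists W; split=> // e es We; apply: contrapT => ne.
by apply: (WO _ We); exists e => //; exact: subset_closure.
Qed.

(** [A0] consists of the open sets whose closure is disjoint from a member of a
    filter on K without cluster point in K.  Finitely many such closures miss a
    common member of the filter, hence a point of K. *)
Lemma not_compact_cover (X : topologicalType) (K : set X) :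
    regular_space X -> closed K -> ~ compact K ->
  exists A0 : set (set X),
    [/\ open_cover A0,
        forall U W, A0 U -> open W -> W `<=` U -> A0 W &
        forall B, finite_set B -> B `<=` A0 ->
          exists2 x, K x & ~ closure (\bigcup_(U in B) U) x].
Proof.
move=> rX cK nK.
have [F [PF FK noF]] : exists F : set_system X,
    [/\ ProperFilter F, F K & forall x, K x -> ~ cluster F x].
  apply: contrapT => noF; apply: nK => F PF FK; apply: contrapT => KF.
  apply: noF; exists F; split=> // x Kx Fx; apply: KF.
  by exists x.
exists [set W | open W /\ exists2 N, F N & closure W `&` N = set0]; split.
- split=> [U []//|]; rewrite -subTset => x _.
  have [Kx|nKx] := pselect (K x); last first.
    have [W [oW Wx WK]] := regular_shrink rX (closed_openC cK) nKx.
    exists W => //; split=> //; exists K => //.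
    by rewrite -subset0 => y [/WK].
  have [N [U [FN nU NU]]] : exists N U, [/\ F N, nbhs x U & N `&` U = set0].
    apply: contrapT => nNU; apply: (noF x Kx) => N U FN nU.
    by apply/set0P/negP => /eqP NU; apply: nNU; exists N, U.
  move: nU; rewrite nbhsE => -[V [oV Vx] VU].
  have [W [oW Wx WV]] := regular_shrink rX oV Vx.
  exists W => //; split=> //; exists N => //.
  by rewrite -subset0 => y [/WV /VU Uy Ny]; rewrite -NU.
- move=> U W [_ [N FN UN]] oW WU; split=> //; exists N => //.
  rewrite -subset0 => y [Wy Ny]; rewrite -UN; split=> //.
  exact: closure_subset Wy.
- move=> B fB BA.
  have /choice[N NP] : forall U, exists N, B U -> F N /\ closure U `&` N = set0.
    move=> U; have [BU|nBU] := pselect (B U); last by exists setT.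
    by have [_ [N FN UN]] := BA _ BU; exists N.
  have FI : F (K `&` \bigcap_(U in B) N U).
    apply: filterI => //; have /finite_fsetP[D BD] := fB; rewrite BD.
    by apply: filter_bigI => U UD; have [|//] := NP U; rewrite BD.
  have [x [Kx Ix]] := filter_ex FI.
  exists x => // /(closure_finite_bigcup fB)[U BU Ux].
  have [_ UN] := NP _ BU; suff : set0 x by [].
  by rewrite -UN; split=> //; exact: Ix.
Qed.

(** * Pairing and limits of finite sequences *)

Local Notation code := CodeSeq.code.
Local Notation decode := CodeSeq.decode.

(** A coding of pairs that dominates its first component, so that what is
    created at time [i] and gets the number [n] can be scheduled for time
    [cpair i n], which is never earlier. *)
Definition cpair (i n : nat) : nat := code [:: i; n].
Definition cfst (j : nat) : nat := nth 0%N (decode j) 0.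
Definition csnd (j : nat) : nat := nth 0%N (decode j) 1.

Lemma cfst_cpair i n : cfst (cpair i n) = i.
Proof. by rewrite /cfst /cpair CodeSeq.codeK. Qed.

Lemma csnd_cpair i n : csnd (cpair i n) = n.
Proof. by rewrite /csnd /cpair CodeSeq.codeK. Qed.

Lemma leq_cpair i n : (i <= cpair i n)%N.
Proof. by have /=/andP[/ltnW] := CodeSeq.ltn_code [:: i; n]. Qed.

Lemma leq_cfst j : (cfst j <= j)%N.
Proof.
have := CodeSeq.ltn_code (decode j); rewrite CodeSeq.decodeK /cfst.
by case: (decode j) => //= i s /andP[/ltnW].
Qed.

Lemma mkseq_cat_cons (T : Type) (a : nat -> T) n c x e :
  mkseq a n = c ++ x :: e -> c = mkseq a (size c) /\ x = a (size c).
Proof.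
move=> aE.
have sn : (size c < n)%N.
  by rewrite -(size_mkseq a n) aE size_cat /= addnS ltnS leq_addr.
have nE : n = (size c + (n - size c))%N by rewrite subnKC// ltnW.
split.
  have := congr1 (take (size c)) aE.
  rewrite take_size_cat// /mkseq -map_take take_iota => {1}<-.
  by rewrite (minn_idPl (ltnW sn)).
by rewrite -(nth_mkseq x a sn) aE nth_cat ltnn subnn.
Qed.

(** The value [d] fills the limit where the lengths of the sequences stay
    bounded. *)
Lemma chain_limit (T : Type) (d : T) (cs : nat -> seq T) :
    (forall i, exists e, cs i.+1 = cs i ++ e) ->
  exists a : nat -> T, (forall i, mkseq a (size (cs i)) = cs i) /\
    (forall n, a n = d \/ exists i c e, cs i = c ++ a n :: e).
Proof.
move=> csP.
have csD i k : exists e, cs (i + k) = cs i ++ e.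
  elim: k => [|k [e IH]]; first by exists [::]; rewrite addn0 cats0.
  by have [e' E'] := csP (i + k)%N; exists (e ++ e'); rewrite addnS E' IH catA.
have csnth i k n : (n < size (cs i))%N -> (n < size (cs k))%N ->
    nth d (cs i) n = nth d (cs k) n.
  wlog ik : i k / (i <= k)%N => [W|] ni nk.
    by have [ik|/ltnW ki] := leqP i k; [exact: W|apply/esym/W].
  by have [e] := csD i (k - i)%N; rewrite subnKC// => ->; rewrite nth_cat ni.
have /choice[a aP] : forall n, exists y,
    (forall i, (n < size (cs i))%N -> y = nth d (cs i) n) /\
    (y = d \/ exists i c e, cs i = c ++ y :: e).
  move=> n; have [[i ni]|nn] := pselect (exists i, (n < size (cs i))%N).
    exists (nth d (cs i) n); split=> [k nk|]; first exact: csnth.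
    right; exists i, (take n (cs i)), (drop n.+1 (cs i)).
    by rewrite -drop_nth// cat_take_drop.
  by exists d; split=> [i ni|]; [exfalso; apply: nn; exists i|left].
exists a; split=> [i|n]; last by have [] := aP n.
apply: (@eq_from_nth _ d); rewrite size_mkseq// => n ni.
by rewrite nth_mkseq//; have [/(_ i ni)] := aP n.
Qed.

(** The [j]-th list has one more label than the [j] labels chosen before it, so
    one of its labels is still unused. *)
Lemma greedy_transversal (T : eqType) (L : nat -> seq (nat * T)) :
    (forall j, size (L j) = j.+1 /\ uniq (unzip1 (L j))) ->
  exists c : nat -> nat * T,
    (forall j, c j \in L j) /\ injective (fst \o c).
Proof.
move=> LP.
have /choice[f fP] : forall s : seq (nat * T),
    exists p, p \in L (size s) /\ p.1 \notin unzip1 s.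
  move=> s; have [sL uL] := LP (size s); apply: contrapT => np.
  have : {subset unzip1 (L (size s)) <= unzip1 s}.
    move=> _ /mapP[p pL ->]; apply: contrapT => /negP ps.
    by apply: np; exists p.
  by move=> /(uniq_leq_size uL); rewrite !size_map sL ltnn.
have [c cP] := run_stream (fun s (_ : unit) => f s) (fun=> tt).
have cL j : c j \in L j /\ (c j).1 \notin unzip1 (mkseq c j).
  by have [_ ->] := cP j; have := fP (mkseq c j); rewrite size_mkseq.
exists c; split=> [j|i j /= ij]; first by have [] := cL j.
wlog lij : i j ij / (i < j)%N => [W|].
  by have [/W->//|/W ->//|] := ltngtP i j.
have [_ /negP[]] := cL j; rewrite -ij; apply/mapP; exists (c i) => //.
by apply/mapP; exists i; rewrite // mem_iota.
Qed.

(** * Rothberger subsets and trees of covers *)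

(** The selection property S_1 for F relative to open covers of the ambient
    space, which makes it inherited by subsets.  In a Lindelof space the
    indexing by numbers loses nothing. *)
Definition rothberger (X : topologicalType) (F : set X) : Prop :=
  forall A : nat -> nat -> set X, (forall n m, open (A n m)) ->
    (forall n, \bigcup_m A n m = setT) ->
    exists g : nat -> nat, F `<=` \bigcup_n A n (g n).

(** The pairing splits a sequence of covers into infinitely many infinite rows,
    and each row can be spent on a different set, or again on the same one. *)
Lemma rothberger_rows (X : topologicalType) (F : nat -> set X)
    (A : nat -> nat -> set X) :
    (forall i, rothberger (F i)) -> (forall n m, open (A n m)) ->
    (forall n, \bigcup_m A n m = setT) ->
  exists g : nat -> nat, forall i x, F i x ->
    exists n, A (cpair i n) (g (cpair i n)) x.
Proof.
move=> rF oA cA.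
have /choice[g gP] : forall i, exists g : nat -> nat,
    F i `<=` \bigcup_n A (cpair i n) (g n).
  by move=> i; apply: (rF i (fun n => A (cpair i n))).
exists (fun j => g (cfst j) (csnd j)) => i x /gP[n _ xA].
by exists n; rewrite cfst_cpair csnd_cpair.
Qed.

Lemma rothberger_sub (X : topologicalType) (F G : set X) :
  F `<=` G -> rothberger G -> rothberger F.
Proof.
by move=> FG rG A oA cA; have [g gG] := rG A oA cA; exists g; apply: subset_trans gG.
Qed.

Lemma rothberger_bigcup (X : topologicalType) (F : nat -> set X) :
  (forall i, rothberger (F i)) -> rothberger (\bigcup_i F i).
Proof.
move=> rF A oA cA; have [g gF] := rothberger_rows rF oA cA.
by exists g => x [i _ /gF[n xA]]; exists (cpair i n).
Qed.

Lemma rothberger_countable_index (X : topologicalType) (F : set X)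
    (I : countType) (i0 : I) (A : nat -> I -> set X) :
    rothberger F -> closed F -> (forall n i, open (A n i)) ->
    (forall n, F `<=` \bigcup_i A n i) ->
  exists g : nat -> I, F `<=` \bigcup_n A n (g n).
Proof.
move=> rF cF oA cA.
pose A' n m := A n (odflt i0 (unpickle m)) `|` ~` F.
have [||g gF] := rF A'.
- by move=> n m; apply: openU => //; exact: closed_openC.
- move=> n; rewrite -subTset => x _.
  have [/(cA n)[i _ xA]|nFx] := pselect (F x); last by exists 0%N => //; right.
  by exists (pickle i) => //; left; rewrite pickleK.
exists (fun n => odflt i0 (unpickle (g n))) => x Fx.
by have [n _ [|//]] := gF x Fx; exists n.
Qed.

Lemma open_bounded_forall (X : topologicalType) (P : nat -> set X) n :
  (forall i, open (P i)) -> open [set x | forall i, (i < n)%N -> P i x].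
Proof.
move=> oP; elim: n => [|n IH].
  by rewrite (_ : mkset _ = setT); [exact: openT|rewrite -subTset].
rewrite (_ : mkset _ = [set x | forall i, (i < n)%N -> P i x] `&` P n).
  exact: openI.
apply/seteqP; split=> x.
  by move=> Px; split=> [i ni|]; apply: Px; rewrite ltnS// ltnW.
by move=> [Px Pn] i; rewrite ltnS leq_eqVlt => /predU1P[->//|]; exact: Px.
Qed.

Section Tree.
Context {X : topologicalType}.
Variable U : seq nat -> nat -> set X.
Hypothesis oU : forall s n, open (U s n).
Hypothesis cU : forall s, \bigcup_n U s n = setT.

Definition hit (s t : seq nat) : set X :=
  [set x | exists r k e, t = r ++ k :: e /\ U (s ++ r) k x].

Lemma open_hit s t : open (hit s t).
Proof.
rewrite (_ : hit s t =
  \bigcup_(p in [set p : seq nat * nat * seq nat | t = p.1.1 ++ p.1.2 :: p.2])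
     U (s ++ p.1.1) p.1.2); first by apply: bigcup_open => p _.
apply/seteqP; split=> x; first by move=> [r [k [e [tE xU]]]]; exists (r, k, e).
by move=> [[[r k] e] /= tE xU]; exists r, k, e.
Qed.

(** When only finitely many histories are possible, one continuation [t] can be
    asked to cover a point after all of them. *)
Definition hit_all n t : set X :=
  [set x | forall i, (i < n)%N -> hit (decode i) t x].

Lemma hit_all_code n t x s : hit_all n t x -> (code s < n)%N -> hit s t x.
Proof. by move=> nt sn; have := nt _ sn; rewrite CodeSeq.codeK. Qed.

(** The histories are handled one after the other: the next one is continued by
    the moves found so far and then by a move covering [x]. *)
Lemma exists_hit_all n x : exists t, hit_all n t x.
Proof.
elim: n => [|n [t nt]]; first by exists [::].
have [k _ xU] : (\bigcup_k U (decode n ++ t) k) x by rewrite cU.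
exists (rcons t k) => i; rewrite ltnS leq_eqVlt => /predU1P[->|/nt].
  by exists t, k, [::]; rewrite cats1.
move=> [r [l [e [-> xr]]]]; exists r, l, (rcons e k); split=> //.
by rewrite rcons_cat rcons_cons.
Qed.

(** Histories below [n], continued by [t], stay below [m]; this keeps the number
    of possible histories finite from one block of moves to the next. *)
Definition bounded_block n m (t : seq nat) : Prop :=
  forall s, (code s < n)%N -> (code (s ++ t) < m)%N.

Definition block n m : set X :=
  [set x | exists2 t, bounded_block n m t & hit_all n t x].

Lemma open_block n m : open (block n m).
Proof.
rewrite (_ : block n m = \bigcup_(t in bounded_block n m) hit_all n t).
  by apply: bigcup_open => t _; apply: open_bounded_forall => i; exact: open_hit.
by apply/seteqP; split=> x [t]; exists t.
Qed.

Lemma block_mono n n' m m' :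
  (n' <= n)%N -> (m <= m')%N -> block n m `<=` block n' m'.
Proof.
move=> nn mm x [t tb tx]; exists t.
  by move=> s sn; apply: leq_trans mm; apply: tb; exact: leq_trans nn.
by move=> i ni; apply: tx; exact: leq_trans nn.
Qed.

Lemma exists_block n x : exists m, block n m x.
Proof.
have [t tx] := exists_hit_all n x.
exists (\max_(i < n) code (decode i ++ t)).+1, t => // s sn.
rewrite ltnS; have := leq_bigmax (F := fun i : 'I_n => code (decode i ++ t)).
by move=> /(_ (Ordinal sn)); rewrite /= CodeSeq.codeK.
Qed.

(** A uniform sequence of bounds must work for every point of F infinitely often,
    although the bound that a block needs depends on the point.  The
    Rothberger property is applied to pairs of consecutive blocks, a first one
    from [n] to [a] and a second one from [a] to [c].  If [n] lies between
    [m b] and [m b.+1] and [c] is at most [m b.+2], then either [a] is at most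
    [m b.+1] and the first block fits between [m b] and [m b.+1], or the second
    one fits between [m b.+1] and [m b.+2]. *)
Lemma block_sequence (F : set X) : rothberger F ->
  exists m : nat -> nat, [/\ (0 < m 0)%N, {homo m : b c / (b <= c)%N} &
    forall x N, F x -> exists2 b, (N <= b)%N & block (m b) (m b.+1) x].
Proof.
move=> rF.
(* The pairs of consecutive blocks, with the middle bound [a] depending on the
   point. *)
pose E n c := \bigcup_(a in [set a | (a <= c)%N]) (block n a `&` block a c).
have [| | |g gP] := @rothberger_rows X (fun=> F) E; first by [].

- by move=> n c; apply: bigcup_open => a _; apply: openI; exact: open_block.
- move=> n; rewrite -subTset => x _.
  have [a xa] := exists_block n x; have [c xc] := exists_block a x.
  exists (maxn a c) => //; exists a; first by rewrite /= leq_maxl.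
  by split=> //; apply: block_mono xc; rewrite // leq_maxr.
(* One step beyond [M] bounds all [g n] with [n] at most [M]. *)
pose step M := (M + \sum_(n < M.+1) g n).+1.
pose m b := iter b step 1%N.
have mS b : (m b < m b.+1)%N by rewrite /m iterS /step ltnS leq_addr.
have gm n b : (n <= m b)%N -> (g n <= m b.+1)%N.
  move=> nb; rewrite /m iterS -/(m b) /step ltnW// ltnS.
  apply: leq_trans (leq_addl _ _).
  by rewrite (bigD1 (Ordinal (nb : (n < (m b).+1)%N)))//= leq_addr.
have mM : {homo m : b c / (b <= c)%N} by apply: homo_leq leq_trans _ => // b; exact: ltnW.
exists m; split=> // x N Fx.
have [k [a /= ag [xna xag]]] := gP (m N) x Fx.
set n := cpair (m N) k in ag xna xag *; have Nn : (m N <= n)%N by exact: leq_cpair.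
have [b [bn nb]] : exists b, (m b <= n)%N /\ (n < m b.+1)%N.
  have bm b : (b <= m b)%N by elim: b => // b IH; exact: leq_ltn_trans (mS b).
  have := @ex_maxnP (fun b => (m b <= n)%N) n (ex_intro _ N Nn).
  case=> [b|b bn bmax]; first by apply: leq_trans; exact: bm.
  by exists b; split=> //; rewrite ltnNge; apply/negP => /bmax; rewrite ltnn.
have Nb : (N <= b)%N.
  by rewrite leqNgt; apply/negP => /mM; rewrite leqNgt (leq_ltn_trans Nn nb).
have [ab|/ltnW ba] := leqP a (m b.+1).
  by exists b => //; apply: block_mono xna.
exists b.+1; first exact: leqW.
by apply: block_mono xag => //; exact: (gm n b.+1 (ltnW nb)).
Qed.

(** The families of blocks given by [block_sequence] are not covers of F, but
    every point lies in infinitely many of them.  So the sets of points covered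
    in [j.+1] given distinct blocks do form a cover, for each [j].  A selection
    from these covers offers [j.+1] blocks for its [j]-th member, which leaves
    enough room to use every block at most once. *)
Lemma block_choice (F : set X) : rothberger F -> closed F ->
  exists (m : nat -> nat) (t : nat -> seq nat),
    [/\ (0 < m 0)%N, forall b, bounded_block (m b) (m b.+1) (t b) &
      F `<=` \bigcup_b hit_all (m b) (t b)].
Proof.
move=> rF cF; have [m [m0 mM mP]] := block_sequence rF.
(* [good j L]: [L] offers [j.+1] distinct blocks, each with admissible moves. *)
pose good (j : nat) (L : seq (nat * seq nat)) := [/\ size L = j.+1,
  uniq (unzip1 L) & forall p, p \in L -> bounded_block (m p.1) (m p.1.+1) p.2].
pose L0 j := [seq (i, [::] : seq nat) | i <- iota 0 j.+1].
have good0 j : good j (L0 j).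
  split; first by rewrite size_map size_iota.
    by rewrite /L0 /unzip1 -map_comp map_id_in ?iota_uniq.
  move=> _ /mapP[i _ ->] s /= sm; rewrite cats0.
  by apply: leq_trans sm _; exact: mM.
pose A j (L : seq (nat * seq nat)) := [set x | good j L /\
  forall i, (i < size L)%N ->
    hit_all (m (nth (0%N, [::]) L i).1) (nth (0%N, [::]) L i).2 x].
have [| |h hF] := @rothberger_countable_index X F (seq (nat * seq nat)) [::] A rF cF.
- move=> j L; have [gL|nL] := pselect (good j L); last first.
    rewrite (_ : A j L = set0); first exact: open0.
    by rewrite -subset0 => x [].
  rewrite (_ : A j L = [set x | forall i, (i < size L)%N ->
    hit_all (m (nth (0%N, [::]) L i).1) (nth (0%N, [::]) L i).2 x]).
    apply: (open_bounded_forall (P := fun i =>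
      hit_all (m (nth (0%N, [::]) L i).1) (nth (0%N, [::]) L i).2)) => i.
    by apply: open_bounded_forall => k; exact: open_hit.
  by apply/seteqP; split=> x //; case.
- move=> j x Fx; elim: j => [|j [L _ [[sL uL bL] Lx]]].
    have [b _ [t tb tx]] := mP x 0%N Fx.
    exists [:: (b, t)] => //; split; last by case.
    by split=> // p; rewrite inE => /eqP ->.
  have [b Lb [t tb tx]] := mP x (\max_(p <- L) p.1).+1 Fx.
  exists ((b, t) :: L) => //; split; last by case=> [|i]; [|exact: Lx].
  split=> [|/=|p]; [by rewrite /= sL| |].
    rewrite uL andbT; apply/negP => /mapP[p pL bE].
    have := leq_bigmax_seq (F := fun p : nat * seq nat => p.1) p pL isT.
    by rewrite -bE leqNgt => /negP; apply.
  by rewrite inE => /predU1P[->//|]; exact: bL.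
(* A selection that is not good denotes the empty set and may be replaced. *)
pose L j := if pselect (good j (h j)) is left _ then h j else L0 j.
have gL j : good j (L j).
  by rewrite /L; case: pselect.
have [|c [cL cI]] := @greedy_transversal (seq nat) L.
  by move=> j; have [] := gL j.
have /choice[t tP] : forall b, exists t, bounded_block (m b) (m b.+1) t /\
    forall j, (c j).1 = b -> t = (c j).2.
  move=> b; have [[j jb]|nj] := pselect (exists j, (c j).1 = b).
    exists (c j).2; split.
      by have [_ _ /(_ _ (cL j))] := gL j; rewrite jb.
    by move=> i ib; congr (_ (c _)); apply: cI; rewrite /= ib.
  exists [::]; split=> [s sm|j jb]; last by exfalso; apply: nj; exists j.
  by rewrite cats0; apply: leq_trans sm _; exact: mM.
exists m, t; split=> // [b|x Fx]; first by have [] := tP b.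
have [j _ [gh hx]] := hF x Fx.
have Lh : L j = h j by rewrite /L; case: pselect.
exists (c j).1 => //; have [_ /(_ j erefl) ->] := tP (c j).1.
have := cL j; rewrite Lh => /(nthP (0%N, [::]))[i ih <-]; exact: hx.
Qed.

(** Pawlikowski's theorem for countable covers: a Rothberger set defeats every
    strategy of the player who proposes the covers.  The blocks of
    [block_choice] are played one after the other; each of them starts from a
    history below its bound, so every point of F is covered during one of
    them. *)
Lemma rothberger_branch (F : set X) : rothberger F -> closed F ->
  exists f : nat -> nat, F `<=` \bigcup_n U (mkseq f n) (f n).
Proof.
move=> rF cF; have [m [t [m0 tb tF]]] := block_choice rF cF.
pose s b := flatten (mkseq t b).
have sS b : s b.+1 = s b ++ t b.
  by rewrite /s mkseqS -cats1 flatten_cat /= cats0.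
have sm b : (code (s b) < m b)%N.
  by elim: b => [//|b IH]; rewrite sS; exact: tb.
have [|f [fs _]] := @chain_limit _ 0%N s; first by move=> b; exists (t b).
exists f => x /tF[b _ xb].
have [r [k [e [tE xU]]]] := hit_all_code xb (sm b).
have fE := fs b.+1; rewrite sS {2}tE catA in fE.
have [rE kE] := mkseq_cat_cons fE.
by exists (size (s b ++ r)) => //; rewrite -rE -kE.
Qed.
End Tree.

(** * The kernel of a sigma-ideal *)

Record sigma_ideal (X : Type) (P : set (set X)) : Prop := SigmaIdeal {
  sigma_ideal_sub : forall F G, F `<=` G -> P G -> P F;
  sigma_ideal_bigcup : forall F : nat -> set X,
    (forall n, P (F n)) -> P (\bigcup_n F n);
  sigma_ideal0 : P set0 }.

Definition ideal_kernel (X : topologicalType) (P : set (set X)) : set X :=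
  [set x | forall N, open N -> N x -> ~ P N].

Lemma closed_ideal_kernel (X : topologicalType) (P : set (set X)) :
  closed (ideal_kernel P).
Proof.
rewrite -openC (_ : ~` _ = \bigcup_(N in [set N | open N /\ P N]) N).
  by apply: bigcup_open => N [].
apply/seteqP; split=> [x nx|x [N [oN PN] Nx]]; last by move=> /(_ N oN Nx).
apply: contrapT => nN; apply: nx => N oN Nx PN; apply: nN.
by exists N.
Qed.

(** A point off the kernel has an open neighbourhood in P; countably many of these
    suffice. *)
Lemma ideal_kernel_outside (X : topologicalType) (P : set (set X)) (V : set X) :
  lindelof X -> sigma_ideal P -> open V -> ideal_kernel P `<=` V -> P (~` V).
Proof.
move=> lX [Psub Pcup P0] oV KV.
pose O (N : set X) := [set x | N x /\ open N /\ P N].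
have OP N : open (O N) /\ P (O N).
  have [oPN|nN] := pselect (open N /\ P N).
    by rewrite (_ : O N = N)//; apply/seteqP; split=> [x []|x].
  rewrite (_ : O N = set0); first by split=> //; exact: open0.
  by rewrite -subset0 => x [].
have [|||g gV] := @lindelof_sequence X (set X) set0 O (~` V) lX.
- exact: open_closedC.
- by move=> N; have [] := OP N.
- move=> x nVx; apply: contrapT => nO; apply: nVx; apply: KV => N oN Nx PN.
  by apply: nO; exists N.
by apply: Psub gV _; apply: Pcup => n; have [] := OP (g n).
Qed.

(** The open set left off the closure of finitely many members contains a point
    of the kernel, so it is not in P. *)
Lemma not_compact_ideal_kernel_cover (X : topologicalType) (P : set (set X)) :
    regular_space X -> sigma_ideal P -> ~ compact (ideal_kernel P) ->
  exists A0 : set (set X),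
    [/\ open_cover A0,
        forall U W, A0 U -> open W -> W `<=` U -> A0 W &
        forall B, finite_set B -> B `<=` A0 -> ~ P (~` \bigcup_(U in B) U)].
Proof.
move=> rX [Psub _ _] nK.
have [A0 [cA dA KA]] := not_compact_cover rX (@closed_ideal_kernel X P) nK.
exists A0; split=> // B fB BA PB; have [x Kx nx] := KA B fB BA.
have oC : open (~` closure (\bigcup_(U in B) U)).
  by apply: closed_openC; exact: closed_closure.
apply: (Kx _ oC nx); apply: Psub PB; apply: subsetC; exact: subset_closure.
Qed.

Lemma rothberger_sigma_ideal (X : topologicalType) :
  sigma_ideal (@rothberger X).
Proof.
split; [exact: rothberger_sub|exact: rothberger_bigcup|].
by move=> A _ _; exists (fun=> 0%N).
Qed.

(** * Bob winning the point game *)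

Section Compact_point_plays.
Context {X : topologicalType}.
Variables (r : seq (GX_amove X) -> GX_amove X -> set X) (K : set X) (x0 : X).
Hypothesis rW : @bob_wins_by (GX X) r.
Hypothesis cK : compact K.

Definition answer (s : seq X) (x : X) : set X :=
  r (CompactSet K :: map (@Point X) s) (Point x).

Lemma answer_play (p : nat -> X) :
  [/\ open (r [::] (CompactSet K)), K `<=` r [::] (CompactSet K),
      forall n, open (answer (mkseq p n) (p n)) /\
        answer (mkseq p n) (p n) (p n) &
      r [::] (CompactSet K) `|` \bigcup_n answer (mkseq p n) (p n) <> setT].
Proof.
pose a n := if n is m.+1 then Point (p m) else CompactSet K.
have aE n : mkseq a n.+1 = CompactSet K :: map (@Point X) (mkseq p n).
  elim: n => // n IH; rewrite mkseqS IH [in RHS]mkseqS map_rcons.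
  by rewrite rcons_cons.
have la n : GX_alegal n (a n) by case: n.
have [bl bw] := rW (a := a) (b := fun n => r (mkseq a n) (a n)) (fun=> erefl).
have {}bl n := bl n (fun m _ => la m).
split.
- by have [] := bl 0%N.
- by have [] := bl 0%N.
- by move=> n; have [] := bl n.+1; rewrite aE.
move=> rT; apply: (bw la); rewrite -rT; apply/seteqP; split=> x.
  by move=> [[|n] _] /=; [left|rewrite aE; right; exists n].
by move=> [|[n _]] xr; [exists 0%N|exists n.+1; rewrite //= aE].
Qed.

Lemma answer_open s x : open (answer s x) /\ answer s x x.
Proof.
have [_ _ /(_ (size s)) + _] := answer_play (nth x0 (rcons s x)).
rewrite nth_rcons ltnn eqxx (_ : mkseq _ _ = s)//.
apply: (@eq_from_nth _ x0); rewrite size_mkseq// => i si.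
by rewrite nth_mkseq// nth_rcons si.
Qed.

(** By the Lindelof property the answers to countably many points already cover X
    in each position.  This gives a tree of countable covers, and a branch
    covering the complement of Bob's first answer is a play that Bob loses. *)
Lemma answer_not_rothberger :
  lindelof X -> ~ rothberger (~` r [::] (CompactSet K)).
Proof.
move=> lX rF.
have [oV KV _ _] := answer_play (fun=> x0).
have /choice[e eP] : forall s : seq X, exists e : nat -> X,
    setT `<=` \bigcup_n answer s (e n).
  move=> s; apply: (lindelof_sequence x0 lX closedT).
    by move=> x; have [] := answer_open s x.
  by move=> x _; exists x => //; have [] := answer_open s x.
pose U s n := answer (run e s) (e (run e s) n).
have [||f fF] := @rothberger_branch X U _ _ _ rF (open_closedC oV).
- by move=> s n; have [] := answer_open (run e s) (e (run e s) n).
- by move=> s; rewrite -subTset; exact: eP.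
have [p pP] := run_stream e f.
have [_ _ _] := answer_play p; apply; rewrite -subTset => x _.
have [Vx|/fF[n _ xU]] := pselect (r [::] (CompactSet K) x); first by left.
by right; exists n => //; have [pE ->] := pP n; move: xU; rewrite /U pE.
Qed.

End Compact_point_plays.

Section Refining_covers.
Context {X : topologicalType}.
Variables (A0 : set (set X)) (w : set X -> nat -> nat -> set X).
Hypothesis cA0 : open_cover A0.
Hypothesis dA0 : forall U W, A0 U -> open W -> W `<=` U -> A0 W.
Hypothesis nA0 : forall B, finite_set B -> B `<=` A0 ->
  ~ rothberger (~` \bigcup_(U in B) U).
Hypothesis wP : forall G, ~ rothberger G ->
  [/\ forall n m, open (w G n m), forall n, \bigcup_m w G n m = setT &
      forall g, ~ G `<=` \bigcup_n w G n (g n)].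

Definition missed (B : nat -> set (set X)) (j : nat) : set X :=
  ~` \bigcup_(U in \bigcup_(i in `I_j) B i) U.

(** After [n] selections, the cover refines the first [n * n.+1] covers of every
    sequence witnessing that what the first [j] selections missed, for [j] at
    most [n], is not Rothberger.  A bound [k] on the selections is not known in
    advance; from inning [k] on, the [l]-th set chosen in inning [n] can be
    charged to cover number [n * k + l], and distinct choices are charged to
    distinct covers. *)
Definition refining_cover (s : seq (set (set X))) : set (set X) :=
  [set W | A0 W /\ forall j, (j < (size s).+1)%N ->
     forall i, (i < size s * (size s).+1)%N ->
       exists m, W `<=` w (missed (nth set0 s) j) i m].

Lemma missed_not_rothberger (B : nat -> set (set X)) j :
    (forall i, (i < j)%N -> finite_set (B i) /\ B i `<=` A0) ->
  ~ rothberger (missed B j).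
Proof.
move=> BP; apply: nA0; first by apply: bigcup_finite => // i /BP[].
by move=> U [i /= /BP[_]]; apply.
Qed.

Lemma open_refining_cover s :
    (forall i, (i < size s)%N ->
      finite_set (nth set0 s i) /\ nth set0 s i `<=` A0) ->
  open_cover (refining_cover s).
Proof.
move=> sP; split=> [U [AU _]|]; first by have [oA _] := cA0; exact: oA.
rewrite -subTset => x _.
have wj j : (j < (size s).+1)%N -> ~ rothberger (missed (nth set0 s) j).
  by rewrite ltnS => js; apply: missed_not_rothberger => i ij; apply: sP;
    exact: leq_trans js.
have /choice[m mP] : forall p : nat * nat, exists m,
    (p.1 < (size s).+1)%N -> w (missed (nth set0 s) p.1) p.2 m x.
  move=> [j i] /=; have [js|//] := ltnP j (size s).+1; last by exists 0%N.
  have [_ /(_ i) wT _] := wP (wj _ js).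
  by have [m _ xm] : (\bigcup_m w (missed (nth set0 s) j) i m) x;
    [rewrite wT|exists m].
have [oA AT] := cA0.
have [W0 AW0 xW0] : (\bigcup_(U in A0) U) x by rewrite AT.
pose O j := [set y | forall i, (i < size s * (size s).+1)%N ->
  w (missed (nth set0 s) j) i (m (j, i)) y].
pose O' j := [set y | (j < (size s).+1)%N -> O j y].
have oO' j : open (O' j).
  have [js|js] := pselect (j < (size s).+1)%N; last first.
    rewrite (_ : O' j = setT); first exact: openT.
    by rewrite -subTset => y _ /js.
  rewrite (_ : O' j = O j).
    by apply: (open_bounded_forall (P := fun i => w _ i _)) => i;
      have [] := wP (wj _ js).
  by apply/seteqP; split=> y Oy; [exact: Oy|move=> _].
have oW : open (W0 `&` [set y | forall j, (j < (size s).+1)%N -> O' j y]).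
  by apply: openI; [exact: oA|exact: open_bounded_forall].
exists (W0 `&` [set y | forall j, (j < (size s).+1)%N -> O' j y]).
  split; first by apply: dA0 AW0 oW _; exact: subIsetl.
  by move=> j js i il; exists (m (j, i)) => y [_ /(_ j js js)]; apply.
by split=> // j js _ i _; exact: (mP (j, i)).
Qed.

(** If the selections have at most [k] members, those from inning [k] on are
    contained in a selection of one set from each witnessing cover for the set
    missed by the first [k] selections, so they do not cover that set. *)
Lemma refining_cover_wins : @alice_wins_by (Gbnd X) refining_cover.
Proof.
move=> A B AE.
have legalB n : (forall m, (m < n)%N -> finite_set (B m) /\ B m `<=` A m) ->
    forall i, (i < n)%N -> finite_set (B i) /\ B i `<=` A0.
  move=> BA i ni; have [fB Bi] := BA i ni; split=> // U /Bi; rewrite AE.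
  by case.
split=> [n BA|BA] /=.
  rewrite AE; apply: open_refining_cover => i; rewrite size_mkseq => ni.
  by rewrite nth_mkseq//; exact: (legalB n).
move=> [[_ BT] [k0 Bk]].
(* A positive bound, since [k] is used as a divisor. *)
pose k := k0.+1.
have {}Bk n : B n #<= `I_k by apply: card_le_trans (Bk n) _; rewrite card_le_II.
have [ow cw nw] := wP (missed_not_rothberger (legalB k (fun m _ => BA m))).
have missedE n : (k <= n)%N -> missed (nth set0 (mkseq B n)) k = missed B k.
  move=> kn; rewrite /missed !bigcup_bigcup; congr (~` _).
  by apply: eq_bigcupr => i /= ik; rewrite nth_mkseq// (leq_trans ik).
have /choice[e eP] : forall n, exists e : nat -> set X, B n `<=` e @` `I_k.
  move=> n; have [->|/unsquash e] := pfcard_geP (Bk n).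
    by exists (fun=> set0).
  by exists e => U BU; have [i ik <-] := 'surj_e BU; exists i.
have /choice[g gP] : forall i, exists m, forall n l, (k <= n)%N -> (l < k)%N ->
    i = (n * k + l)%N -> B n (e n l) -> e n l `<=` w (missed B k) i m.
  move=> i; have [[n [l [kn lk iE Bn]]]|nn] := pselect (exists n l,
      [/\ (k <= n)%N, (l < k)%N, i = (n * k + l)%N & B n (e n l)]); last first.
    by exists 0%N => n l kn lk iE Bn; exfalso; apply: nn; exists n, l.
  have [_] := BA n; rewrite AE => /(_ _ Bn)[_]; rewrite size_mkseq.
  have ni : (i < n * n.+1)%N.
    rewrite iE mulnS [(n + _)%N]addnC -addnS leq_add// ?leq_mul//.
    exact: leq_trans kn.
  move=> /(_ k _ i ni)[|m]; first by rewrite ltnS.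
  rewrite missedE// => em; exists m => n' l' kn' lk' iE' _.
  suff [-> ->] : n' = n /\ l' = l by [].
  have := iE'; rewrite iE => nl.
  have := congr1 (divn^~ k) nl; have := congr1 (modn^~ k) nl.
  by rewrite !modnMDl !divnMDl// !modn_small// !divn_small// !addn0.
apply: (nw g) => x xm.
have [U [n _ BU] Ux] : (\bigcup_(U in \bigcup_n B n) U) x by rewrite BT.
have kn : (k <= n)%N.
  rewrite leqNgt; apply/negP => nk; apply: xm; exists U => //.
  by exists n.
have [l lk UE] := eP n U BU.
by exists (n * k + l)%N => //; apply: (gP _ n l) => //; rewrite UE.
Qed.

End Refining_covers.

Lemma bob_GX_alice_Gbnd (X : topologicalType) : regular_space X ->
  bob_has_winning_strategy (GX X) -> alice_has_winning_strategy (Gbnd X).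
Proof.
move=> rX /bob_wins_byP[r rW]; apply/alice_wins_byP.
have [[x0 _]|X0] := pselect (exists x : X, True); last first.
  have XF (x : X) : False by apply: X0; exists x.
  pose a n : GX_amove X := if n is _.+1 then NoPoint else CompactSet set0.
  have [_ bw] := rW a (fun n => r (mkseq a n) (a n)) (fun=> erefl).
  exfalso; apply: bw => [[|n] /=|].
  - by split=> //; exact: compact0.
  - by [].
  - by apply/seteqP; split=> x; have := XF x.
have [lX|nlX] := pselect (lindelof X); last first.
  have [A [cA nA]] : exists A : set (set X), open_cover A /\
      ~ exists C, [/\ countable C, C `<=` A & \bigcup_(U in C) U = setT].
    apply: contrapT => nA; apply: nlX => A cA; apply: contrapT => nC.
    by apply: nA; exists A.
  exists (fun=> A) => a B aE; split=> [n _|BA [cB _]] /=; first by rewrite aE.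
  apply: nA; apply: Gbnd_constant_play cB => n; rewrite -(aE n); exact: BA.
have [cK|nK] := pselect (compact (ideal_kernel (@rothberger X))).
  have [oV KV _ _] := answer_play rW cK (fun=> x0).
  exfalso; apply: (answer_not_rothberger x0 rW cK lX).
  exact: ideal_kernel_outside (rothberger_sigma_ideal X) oV KV.
have [A0 [cA dA nA]] :=
  not_compact_ideal_kernel_cover rX (rothberger_sigma_ideal X) nK.
have /choice[w wP] : forall G : set X, exists w : nat -> nat -> set X,
    ~ rothberger G -> [/\ forall n m, open (w n m),
      forall n, \bigcup_m w n m = setT &
      forall g, ~ G `<=` \bigcup_n w n (g n)].
  move=> G; have [rG|nG] := pselect (rothberger G).
    by exists (fun _ _ => set0).
  apply: contrapT => nw; apply: nG => A oA cA'.
  apply: contrapT => ng; apply: nw; exists A => _; split=> // g gG.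
  by apply: ng; exists g.
by exists (refining_cover A0 w); exact: refining_cover_wins.
Qed.

(** * Countably branching plans for Alice's points *)

(** A way of playing points that branches countably.  Each [task] consists in
    playing one point for the sake of the [pending] points of X; what Bob's
    answer leaves pending is split among countably many new tasks.  A point
    is covered as soon as it cannot remain pending along an infinite branch. *)
Record plan (X : Type) := Plan {
  task : Type;
  start : nat -> task;
  point_of : task -> X;
  next : task -> set X -> nat -> task;
  pending : task -> set X }.

Record plan_covers (X : topologicalType) (S : plan X) (F : set X) : Prop :=
  PlanCovers {
    plan_start : F `<=` \bigcup_n pending (start S n);
    plan_next : forall (s : task S) V, open V -> V (point_of s) ->
      pending s `\` V `<=` \bigcup_n pending (next s V n);
    (* [T] is a nonempty set of tasks without end, that is, the germ of an
       infinite branch along which [x] would stay pending. *)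
    plan_escape : forall x (T : set (task S)),
      (forall s, T s -> pending s x /\ exists V n, T (next s V n)) ->
      forall s, ~ T s }.

Definition point_winning (X : topologicalType) (F : set X) : Prop :=
  exists S : plan X, plan_covers S F.

Section Schedule.
Context {X : topologicalType} (S : plan X).

(** [gs] lists the families of tasks created in the innings played so far.  Task
    [n] of the family number [i], where number 0 is the initial family, is
    served in inning [cpair i n]. *)
Definition scheduled (gs : seq (nat -> task S)) : task S :=
  nth (start S) (start S :: gs) (cfst (size gs)) (csnd (size gs)).

Definition created : seq (set X) -> seq (nat -> task S) :=
  run (fun gs V => next (scheduled gs) V).

(** Every task is eventually served, so an uncovered point would pass from task to
    task for ever. *)
Lemma plan_strategy (F : set X) (V : nat -> set X) :
    plan_covers S F ->
    (forall n, open (V n) /\ V n (point_of (scheduled (created (mkseq V n))))) ->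
  F `<=` \bigcup_n V n.
Proof.
move=> [SF Snext Sesc] VP x Fx; apply: contrapT => nV.
have [g gP] := run_stream (fun gs V => next (scheduled gs) V) V.
pose q j := scheduled (mkseq g j).
have qE j : q j = (if cfst j is i.+1 then g i else start S) (csnd j).
  rewrite /q /scheduled size_mkseq; have := leq_cfst j.
  by case: (cfst j) => //= i ij; rewrite nth_mkseq.
have [n _ xn] := SF x Fx.
apply: (Sesc x [set s | exists2 j, s = q j & pending (q j) x]
  _ (q (cpair 0 n))); last first.
  by exists (cpair 0 n) => //; rewrite qE cfst_cpair csnd_cpair.
move=> _ [j -> xj]; split=> //.
have [oV Vj] := VP j; have [gE gj] := gP j.
rewrite /created gE -/(q j) in Vj.
have [|m _ xm] := Snext (q j) (V j) oV Vj x.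
  by split=> // Vx; apply: nV; exists j.
have qm : q (cpair j.+1 m) = next (q j) (V j) m.
  by rewrite qE cfst_cpair csnd_cpair gj.
by exists (V j), m, (cpair j.+1 m); rewrite qm.
Qed.

End Schedule.

Lemma point_winning_sigma_ideal (X : topologicalType) :
  X -> sigma_ideal (@point_winning X).
Proof.
move=> x0; split.
- move=> F G FG [S [SG Sn Se]]; exists S; split=> //; exact: subset_trans SG.
- move=> F /choice[S SP].
  exists {| task := {i & task (S i)};
    start := fun n => Tagged (fun i => task (S i)) (start (S (cfst n)) (csnd n));
    point_of := fun s => point_of (tagged s);
    next := fun s V n => Tagged (fun i => task (S i)) (next (tagged s) V n);
    pending := fun s => pending (tagged s) |}.
  split=> /=.
  + move=> x [i _ Fx]; have [/(_ x Fx)[n _ xn] _ _] := SP i.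
    by exists (cpair i n) => //; rewrite cfst_cpair csnd_cpair.
  + by move=> [i s] V oV Vs x xs; have [_ /(_ s V oV Vs x xs)] := SP i.
  + move=> x T TP [i s] Ts; have [_ _ Se] := SP i.
    apply: (Se x [set s | T (Tagged (fun i => task (S i)) s)] _ s Ts) => t /TP[xt [V [n Tn]]].
    by split=> //; exists V, n.
- exists {| task := unit; start := fun=> tt; point_of := fun=> x0;
    next := fun _ _ _ => tt; pending := fun=> set0 |}.
  by split=> //= [s V _ _ x []//|x T TP s /TP[]].
Qed.

(** * Bounded answers *)

(** The common closure of all answers is contained in the closures of finitely
    many points.  Otherwise it contains points y_0, ..., y_k none of which is
    in the closure of an earlier one.  Some cover has members whose closures
    contain at most one of them each, and the answer to this cover needs more
    than [k] members to reach all of them. *)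
Lemma bounded_answers_finite_kernel (X : topologicalType)
    (A0 : set (set X)) (R : set (set X) -> set (set X)) (k : nat) :
    regular_space X -> open_cover A0 ->
    (forall U W, A0 U -> open W -> W `<=` U -> A0 W) ->
    (forall A, open_cover A -> A `<=` A0 -> R A `<=` A /\ R A #<= `I_k) ->
  exists E : seq X, forall y,
    (forall A, open_cover A -> A `<=` A0 -> closure (\bigcup_(U in R A) U) y) ->
    exists2 e, e \in E & closure [set e] y.
Proof.
move=> rX [oA AT] dA RP; apply: contrapT => nE.
have /choice[f fP] : forall E : seq X, exists y,
    (forall A, open_cover A -> A `<=` A0 ->
       closure (\bigcup_(U in R A) U) y) /\
    forall e, e \in E -> ~ closure [set e] y.
  move=> E; apply: contrapT => ny; apply: nE; exists E => y yR.
  apply: contrapT => nye; apply: ny; exists y; split=> // e eE ye.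
  by apply: nye; exists e.
have [y yP] := run_stream (fun s (_ : unit) => f s) (fun=> tt).
have yf j : y j = f (mkseq y j) by have [] := yP j.
have ysep i j : (i < j)%N -> ~ closure [set y i] (y j).
  move=> ij; rewrite [y j]yf; have [_ ] := fP (mkseq y j); apply.
  by apply/mapP; exists i; rewrite // mem_iota.
pose A := [set W | A0 W /\ forall i j, (i < j)%N -> (j <= k)%N ->
  ~ (closure W (y i) /\ closure W (y j))].
have AA0 : A `<=` A0 by move=> W [].
have cA : open_cover A.
  split=> [W [/oA]//|]; rewrite -subTset => z _.
  have [W0 AW0 W0z] : (\bigcup_(U in A0) U) z by rewrite AT.
  have [W [oW Wz Wy]] := separate_points (mkseq y k.+1) z rX.
  have oWW : open (W `&` W0) by apply: openI => //; exact: oA.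
  exists (W `&` W0) => //; split; first by apply: dA AW0 oWW _; exact: subIsetr.
  move=> i j ij jk [Wi Wj].
  have zc l : (l <= k)%N -> closure (W `&` W0) (y l) -> closure [set y l] z.
    move=> lk Wl; apply: Wy; last exact: (closure_subset (@subIsetl _ _ _) Wl).
    by apply/mapP; exists l; rewrite // mem_iota.
  apply: (ysep i j ij); apply: (closure1_trans (y := z)).
    by apply: zc Wi; rewrite (leq_trans (ltnW ij)).
  by apply: regular_closure1_sym => //; exact: zc.
have [_ Rk] := RP A cA AA0.
have [RA _] := RP A cA AA0.
have fR : finite_set (R A) by apply: card_le_finite Rk _; exact: finite_II.
have /choice[W WP] : forall i, exists W, R A W /\ closure W (y i).
  move=> i; have [yR _] := fP (mkseq y i); rewrite -yf in yR.
  by have [W RW Wy] := closure_finite_bigcup fR (yR A cA AA0); exists W.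
suff : `I_k.+1 #<= `I_k by rewrite card_le_II ltnn.
have WI : {in `I_k.+1 &, injective W}.
  move=> i j; rewrite !inE /= => ik jk Wij.
  wlog ij : i j ik jk Wij / (i < j)%N => [H|].
    by have [ij|ji|//] := ltngtP i j; [exact: H|apply/esym/H].
  have [/RA[_ /(_ i j ij jk)] []] := WP i.
  by split; [have [] := WP i|rewrite Wij; have [] := WP j].
have := inj_card_eq WI; rewrite card_eq_le => /andP[_ kW].
apply: card_le_trans kW _; apply: card_le_trans Rk; apply: subset_card_le.
by move=> _ [i _ <-]; have [] := WP i.
Qed.

(** Around [x], only points indistinguishable from [x] can escape being separated
    from some answer.  An open set containing [x] contains them as well, so a
    single point settles the neighbourhood [N]. *)
Lemma bounded_answers_local (X : topologicalType)
    (A0 : set (set X)) (R : set (set X) -> set (set X)) (k : nat) (x : X) :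
    regular_space X -> open_cover A0 ->
    (forall U W, A0 U -> open W -> W `<=` U -> A0 W) ->
    (forall A, open_cover A -> A `<=` A0 -> R A `<=` A /\ R A #<= `I_k) ->
  exists N, [/\ open N, N x & forall y, closure N y ->
    (forall A, open_cover A -> A `<=` A0 -> closure (\bigcup_(U in R A) U) y) ->
    closure [set y] x].
Proof.
move=> rX cA dA RP.
have [E EP] := bounded_answers_finite_kernel rX cA dA RP.
have [N [oN Nx NE]] := separate_points E x rX.
exists N; split=> // y Ny /EP[e eE ye].
have ey : closure [set y] e by exact: regular_closure1_sym.
apply: (closure1_trans ey); apply: NE => //; exact: closure1_trans Ny ey.
Qed.

(** * Bob winning the bounded covering game *)

Section Bounded_positions.
Context {X : topologicalType}.
Variables (r : seq (set (set X)) -> set (set X) -> set (set X))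
  (A0 : set (set X)) (x0 : X).
Hypothesis rX : regular_space X.
Hypothesis rW : @bob_wins_by (Gbnd X) r.
Hypothesis cA0 : open_cover A0.
Hypothesis dA0 : forall U W, A0 U -> open W -> W `<=` U -> A0 W.

Lemma bob_play (a : nat -> set (set X)) : (forall n, open_cover (a n)) ->
  [/\ forall n, finite_set (r (mkseq a n) (a n)) /\ r (mkseq a n) (a n) `<=` a n,
      \bigcup_n \bigcup_(U in r (mkseq a n) (a n)) U = setT &
      exists k, forall n, r (mkseq a n) (a n) #<= `I_k].
Proof.
move=> ca.
have [bl bw] := rW (a := a) (b := fun n => r (mkseq a n) (a n)) (fun=> erefl).
have [[_ bT] bk] := bw ca.
split=> //; last by rewrite -bigcup_bigcup.
by move=> n; apply: bl => m _; exact: ca.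
Qed.

Definition position (s : seq (set (set X))) : Prop :=
  forall A, A \in s -> open_cover A /\ A `<=` A0.

Lemma position_rcons s A :
  position (rcons s A) <-> position s /\ open_cover A /\ A `<=` A0.
Proof.
split=> [sP|[sP AP] B]; last by rewrite mem_rcons inE => /predU1P[->|/sP].
split=> [B Bs|]; apply: sP; rewrite mem_rcons inE ?eqxx//.
by rewrite Bs orbT.
Qed.

Lemma answer_legal s A : position (rcons s A) ->
  finite_set (r s A) /\ r s A `<=` A.
Proof.
move=> sP; pose a n := nth A (rcons s A) n.
have [|/(_ (size s)) + _ _] := bob_play (a := a).
  move=> n; rewrite /a; have [ns|ns] := ltnP n (size (rcons s A)).
    by have [] := sP _ (mem_nth A ns).
  by rewrite nth_default//; have /position_rcons[_ []] := sP.
rewrite /a nth_rcons ltnn eqxx (_ : mkseq _ _ = s)//.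
apply: (@eq_from_nth _ A); rewrite size_mkseq// => i si.
by rewrite nth_mkseq// nth_rcons si.
Qed.

Definition picked (s : seq (set (set X))) : set (set X) :=
  \bigcup_(i in `I_(size s)) r (take i s) (nth A0 s i).

Lemma picked_rcons s A : picked (rcons s A) = picked s `|` r s A.
Proof.
rewrite /picked size_rcons IIS bigcup_setU bigcup_set1.
rewrite nth_rcons ltnn eqxx -cats1 take_size_cat//; congr (_ `|` _).
by apply: eq_bigcupr => i /= si; rewrite nth_cat si takel_cat// ltnW.
Qed.

Lemma picked_position s : position s ->
  finite_set (picked s) /\ picked s `<=` A0.
Proof.
elim/last_ind: s => [|s A IH sP].
  by move=> _; rewrite /picked II0 bigcup_set0; split=> //; exact: finite_set0.
have [fA rA] := answer_legal sP.
have [/IH[fs sA0] [_ AA0]] := (position_rcons _ _).1 sP.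
rewrite picked_rcons; split; first by rewrite finite_setU.
by move=> U [/sA0//|/rA /AA0].
Qed.

Definition covered s : set X := \bigcup_(U in picked s) U.

Lemma covered_rcons s A :
  covered (rcons s A) = covered s `|` \bigcup_(U in r s A) U.
Proof. by rewrite /covered picked_rcons bigcup_setU. Qed.

Lemma covered_mkseq (a : nat -> set (set X)) n i x : (i < n)%N ->
  (\bigcup_(U in r (mkseq a i) (a i)) U) x -> covered (mkseq a n) x.
Proof.
elim: n => // n IH; rewrite ltnS leq_eqVlt mkseqS covered_rcons.
by case/predU1P => [->|/IH xi /xi]; [right|left].
Qed.

Lemma chain_play (s : nat -> seq (set (set X))) :
    (forall i, exists d A, s i.+1 = s i ++ rcons d A) ->
    (forall i, position (s i)) ->
  exists a, (forall n, open_cover (a n)) /\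
    forall i, mkseq a (size (s i)) = s i /\ (i <= size (s i))%N.
Proof.
move=> sS sP; have [|a [as_ aP]] := @chain_limit _ A0 s.
  by move=> i; have [d [A ->]] := sS i; exists (rcons d A).
exists a; split=> [n|i].
  have [->//|[i [c [e siE]]]] := aP n.
  by have [] := sP i (a n); rewrite // siE mem_cat inE eqxx orbT.
split=> //; elim: i => // i IH; have [d [A ->]] := sS i.
by rewrite size_cat size_rcons addnS ltnS (leq_trans IH)// leq_addr.
Qed.

(** The tasks are pairs of a position extending [s0] and a point [x]; pending are
    the points of the neighbourhood of [x] from [bounded_answers_local] that
    are not covered in the position.  Once [x] is covered by an open set, every
    other point nearby is off the closure of the answer to some cover, and that
    cover is appended to the position.  An infinite branch is a play of the
    covering game, in which Bob covers everything. *)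
Lemma bounded_position_point_winning (s0 : seq (set (set X))) (k : nat) :
    lindelof X -> position s0 ->
    (forall d A, position (s0 ++ rcons d A) -> r (s0 ++ d) A #<= `I_k) ->
  point_winning (~` covered s0).
Proof.
move=> lX s0P s0k.
pose ext s := position s /\ exists d, s = s0 ++ d.
have extr s A : ext s -> open_cover A -> A `<=` A0 -> ext (rcons s A).
  move=> [sP [d sE]] cA AA; split; first by apply/position_rcons.
  by exists (rcons d A); rewrite sE rcons_cat.
have ansP s A : ext s -> open_cover A -> A `<=` A0 ->
    r s A `<=` A /\ r s A #<= `I_k.
  move=> es cA AA; have [sAP _] := extr s A es cA AA.
  have [_ [d sE]] := es; have [_ rA] := answer_legal sAP; split=> //.
  by rewrite sE; apply: s0k; rewrite -rcons_cat -sE.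
have /choice[N NP] : forall p : seq (set (set X)) * X, exists N, ext p.1 ->
    [/\ open N, N p.2 & forall y, closure N y ->
    (forall A, open_cover A -> A `<=` A0 ->
       closure (\bigcup_(U in r p.1 A) U) y) ->
    closure [set y] p.2].
  move=> [s x] /=; have [es|ns] := pselect (ext s); last by exists setT.
  by have [N] := bounded_answers_local x rX cA0 dA0 (ansP s ^~ es); exists N.
pose task := (seq (set (set X)) * X)%type.
(* The new tasks: a cover to append to the position, and a point near which the
   pending points are handled next. *)
have /choice[nx nxP] : forall q : task * set X, exists g : nat -> set (set X) * X,
    ext q.1.1 -> open q.2 -> q.2 q.1.2 -> forall y, closure (N q.1) y -> ~ q.2 y ->
    exists n, [/\ open_cover (g n).1, (g n).1 `<=` A0,
      N (rcons q.1.1 (g n).1, (g n).2) y &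
      ~ (\bigcup_(U in r q.1.1 (g n).1) U) y].
  move=> [[s x] V] /=.
  have [[es oV Vx]|nV] := pselect [/\ ext s, open V & V x]; last first.
    by exists (fun=> (A0, x0)) => es oV Vx; exfalso; apply: nV.
  have [oN Nx Ncl] := NP (s, x) es.
  pose O (p : set (set X) * X) := [set y | (open_cover p.1 /\ p.1 `<=` A0) /\
    (N (rcons s p.1, p.2) `&` ~` closure (\bigcup_(U in r s p.1) U)) y].
  have [|||g gP] := @lindelof_sequence X _ (A0, x0) O (closure (N (s, x)) `\` V) lX.
  - apply: closedI; [exact: closed_closure|exact: open_closedC].
  - move=> [A z]; have [[cA AA]|nA] := pselect (open_cover A /\ A `<=` A0).
      rewrite (_ : O _ = N (rcons s A, z) `&` ~` closure (\bigcup_(U in r s A) U)).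
        apply: openI; first by have [] := NP (rcons s A, z) (extr s A es cA AA).
        by apply: closed_openC; exact: closed_closure.
      by apply/seteqP; split=> y; [case|].
    rewrite (_ : O _ = set0); first exact: open0.
    by rewrite -subset0 => y [].
  - move=> y [Ny nVy]; apply: contrapT => nO; apply: nVy.
    have [|z -> //] := closure_meets _ oV Vx (A := [set y]).
    apply: Ncl Ny _ => A cA AA; apply: contrapT => nyA; apply: nO.
    exists (A, y) => //; split=> //; split=> //.
    by have [] := NP (rcons s A, y) (extr s A es cA AA).
  exists g => _ _ _ y Ny nVy.
  have [n _ [[cA AA] [Nn nn]]] := gP y (conj Ny nVy).
  by exists n; split=> // yU; apply: nn; exact: subset_closure.
have es0 : ext s0 by split=> //; exists [::]; rewrite cats0.
have [||x xP] := @lindelof_sequence X X x0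
    (fun x => N (s0, x)) setT lX closedT.
- by move=> x; have [] := NP (s0, x) es0.
- by move=> x _; exists x => //; have [] := NP (s0, x) es0.
exists {| task := task;
  start := fun n => (s0, x n);
  point_of := snd;
  next := fun s V n => (rcons s.1 (nx (s, V) n).1, (nx (s, V) n).2);
  pending := fun s => [set y | [/\ ext s.1, N s y & ~ covered s.1 y]] |}.
split=> /=.
- by move=> y ny; have [n _ yn] := xP y I; exists n.
- move=> [s z] V oV Vz y [[/= es Ny ny] nVy].
  have [n [cA AA Nn nn]] := nxP ((s, z), V) es oV Vz y (subset_closure Ny) nVy.
  exists n => //=; split; [exact: extr|exact: Nn|].
  by rewrite covered_rcons => -[].
- move=> y T TP t Tt.
  have /choice[f fP] : forall s : task, exists s' : task, T s ->
      T s' /\ exists A, s'.1 = rcons s.1 A.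
    move=> s; have [Ts|nTs] := pselect (T s); last by exists s.
    have [_ [V [n Tn]]] := TP s Ts.
    by eexists=> _; split; [exact: Tn|eexists].
  pose u i := iter i f t.
  have Tu i : T (u i) by elim: i => // i IH; have [] := fP _ IH.
  have [||a [ca aP]] := @chain_play (fun i => (u i).1).
  + move=> i; have [_ [A uE]] := fP _ (Tu i).
    by exists [::], A; rewrite /u iterS uE -cats1.
  + by move=> i; have [[[]]] := TP _ (Tu i).
  have [_ aT _] := bob_play ca.
  have [n _ yn] : (\bigcup_n \bigcup_(U in r (mkseq a n) (a n)) U) y by rewrite aT.
  have [[_ _ ny] _] := TP _ (Tu n.+1); apply: ny.
  have [uE nu] := aP n.+1; rewrite -uE; exact: (covered_mkseq nu yn).
Qed.

(** If there were no such position, every position could be extended by an answer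
    with more than [k] members, for [k] = 0, 1, 2, and so on: a play with
    unbounded selections. *)
Lemma exists_point_winning_position : lindelof X ->
  exists2 s, position s & point_winning (~` covered s).
Proof.
move=> lX; apply: contrapT => ns.
have /choice[h hP] : forall q : seq (set (set X)) * nat,
    exists p : seq (set (set X)) * set (set X), position q.1 ->
      position (q.1 ++ rcons p.1 p.2) /\ ~ (r (q.1 ++ p.1) p.2 #<= `I_(q.2)).
  move=> [s k] /=; apply: contrapT => nsk.
  have sP : position s.
    by apply: contrapT => sP; apply: nsk; exists ([::], A0).
  apply: ns; exists s => //; apply: (bounded_position_point_winning (k := k)) => //.
  move=> d A dP; apply: contrapT => dk; apply: nsk.
  by exists (d, A).
pose step s k := s ++ rcons (h (s, k)).1 (h (s, k)).2.
pose s := fix s i := if i is j.+1 then step (s j) j else [::].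
have sP i : position (s i).
  elim: i => [|i IH]; first by move=> A.
  by have [] := hP (s i, i) IH.
have [|a [ca aP]] := @chain_play s _ sP.
  by move=> i; exists (h (s i, i)).1, (h (s i, i)).2.
have [_ _ [k ak]] := bob_play ca.
have [_] := hP (s k, k) (sP k); apply => /=.
have [aE _] := aP k.+1; rewrite /= /step -cats1 catA in aE.
by have [cE AE] := mkseq_cat_cons aE; rewrite cE AE; exact: ak.
Qed.

End Bounded_positions.

Lemma bob_Gbnd_alice_GX (X : topologicalType) : regular_space X ->
  bob_has_winning_strategy (Gbnd X) -> alice_has_winning_strategy (GX X).
Proof.
move=> rX /bob_wins_byP[r rW]; apply/alice_wins_byP.
have [[x0 _]|X0] := pselect (exists x : X, True); last first.
  have XF (x : X) : False by apply: X0; exists x.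
  exists (fun s => if s is _ :: _ then NoPoint else CompactSet set0).
  move=> a b aE; split=> [n _|_].
    by rewrite aE; case: n => //=; split=> //; exact: compact0.
  by apply; apply/seteqP; split=> x; have := XF x.
have lX : lindelof X.
  move=> A cA; have [bl bw] := rW (fun=> A) (fun n => r (mkseq (fun=> A) n) A) (fun=> erefl).
  have [cB _] := bw (fun=> cA); apply: Gbnd_constant_play cB.
  by move=> n; apply: bl => m _; exact: cA.
have iP := point_winning_sigma_ideal x0.
have [cK|nK] := pselect (compact (ideal_kernel (@point_winning X))); last first.
  have [A0 [cA dA nA]] := not_compact_ideal_kernel_cover rX iP nK.
  have [s sP sW] := exists_point_winning_position x0 rX rW cA dA lX.
  have [fs sA] := picked_position rW sP.
  by have := nA _ fs sA sW.
have /choice[S SP] : forall V : set X, exists S : plan X,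
    open V -> ideal_kernel (@point_winning X) `<=` V -> plan_covers S (~` V).
  move=> V; have [[oV KV]|nV] := pselect (open V /\ ideal_kernel (@point_winning X) `<=` V).
    by have [S SV] := ideal_kernel_outside lX iP oV KV; exists S.
  have [_ _ [S _]] := iP.
  by exists S => oV KV; exfalso; apply: nV.
exists (fun s => if s is V :: s' then
  Point (point_of (scheduled (created (S V) s'))) else
  CompactSet (ideal_kernel (@point_winning X))).
move=> a b aE; split=> [n _|bP].
  by rewrite aE; case: n => //= n; split.
apply; have [oV KV] : GX_blegal (a 0%N) (b 0%N) := bP 0%N.
rewrite aE /= in KV; rewrite -subTset => x _.
have [Vx|nVx] := pselect (b 0%N x); first by exists 0%N.
have [|n _ xn] := plan_strategy (V := fun n => b n.+1) (SP _ oV KV) _ nVx; last by exists n.+1.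
move=> n; have [obn] := bP n.+1; rewrite aE /= => bn; split=> //.
by move: bn; rewrite /mkseq (iotaDl 1 0) -map_comp.
Qed.

Theorem theorem6p5 (X : topologicalType) :
  (alice_has_winning_strategy (Gbnd X) -> bob_has_winning_strategy (GX X)) /\
  (alice_has_winning_strategy (GX X) -> bob_has_winning_strategy (Gbnd X)) /\
  (regular_space X ->
    (bob_has_winning_strategy (Gbnd X) -> alice_has_winning_strategy (GX X)) /\
    (bob_has_winning_strategy (GX X) -> alice_has_winning_strategy (Gbnd X))).
Proof.
split; first exact: alice_Gbnd_bob_GX.
split; first exact: alice_GX_bob_Gbnd.
by move=> rX; split; [exact: bob_Gbnd_alice_GX|exact: bob_GX_alice_Gbnd].
Qed.
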